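(* Let $G$ be a cyclic group of prime order $p$, and let $V$ be a representation of $G$ over a field $\Bbbk$ of characteristic $p$ with $\dim(V)=n<\infty$. Let $r$ denote the number of trivial summands in $V$, and let $m$ denote the number of nontrivial indecomposable summands of $V$. Then there exist $n$ homogeneous and generically separating invariants in $\Bbbk[V]^G$ consisting of - $m+r=\dim(V^G)$ invariants of degree $1$, - $m$ invariants of degree $p$, - $n-2m-r$ invariants of degree $2$ or $3$. Furthermore, these $n$ invariants generate the invariant field $\Bbbk(V)^G$ as a field extension of $\Bbbk$.
   Context: $V$ decomposes as a direct sum of indecomposable subrepresentations, uniquely up to isomorphism and order; $r$ and $m$ count, respectively, the trivial (one-dimensional) summands and the nontrivial summands in such a decomposition. $\Bbbk[V]$ is the symmetric algebra of $V^*$, viewed as a (formal) polynomial ring in a basis of $V^*$, with the induced action of $G$ and its standard grading; $\Bbbk[V]^G$ is the ring of invariants, and $\Bbbk(V)^G$ is the subfield of invariants in the rational function field $\Bbbk(V)=\mathrm{Frac}(\Bbbk[V])$. $V^G$ is the subspace of fixed vectors. For a $G$-stable subset $B\subseteq V$, a set $S$ of invariant polynomials is $B$-separating if for any two orbits $Gv\ne Gw$ with $v,w\in B$ there is $f\in S$ with $f(v)\neq f(w)$. A set $S\subseteq \Bbbk[V]^G$ is generically separating if it is $B$-separating for some $G$-stable, nonempty, Zariski open set $B\subseteq V$. In the claim, it is the set of all $n$ invariants together that is generically separating. *)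

(* Defs.v *)
From HB Require Import structures.
From mathcomp Require Export all_boot all_order all_algebra all_fingroup.
From mathcomp Require Export all_solvable mxrepresentation mpoly.
From mathcomp Require Export generic_quotient fraction.

Set Implicit Arguments.
Unset Strict Implicit.
Unset Printing Implicit Defensive.

Import GRing.Theory.
Local Open Scope ring_scope.

(* A representation is an [mx_representation]: V is the space of row vectors  *)
(* 'rV[F]_n, g acts by v |-> v *m rG g (a right action), and                  *)
(* subrepresentations are row spaces U with [mxmodule rG U].                  *)

Section Decomposition.

Variables (F : fieldType) (gT : finGroupType) (G : {group gT}) (n : nat).
Variable rG : mx_representation F G n.

Definition mx_indecomposable (U : 'M[F]_n) : Prop :=
  [/\ mxmodule rG U, U != 0
    & forall U1 U2 : 'M[F]_n, mxmodule rG U1 -> mxmodule rG U2 ->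
        (U1 + U2 :=: U)%MS -> mxdirect (U1 + U2) -> U1 = 0 \/ U2 = 0].

Definition indecomposable_decomposition s (W : 'I_s -> 'M[F]_n) : Prop :=
  [/\ forall i, mx_indecomposable (W i),
      (\sum_i W i :=: 1%:M)%MS
    & mxdirect (\sum_i W i)].

Definition trivial_summand (U : 'M[F]_n) : bool :=
  (\rank U == 1)%N && (U <= rfix_mx rG G)%MS.

End Decomposition.

Section Invariants.

Variables (F : fieldType) (gT : finGroupType) (G : {group gT}) (n : nat).
Variable rG : mx_representation F G n.

(* The indeterminate 'X_i is the i-th coordinate function on 'rV[F]_n, and    *)
(* (g f)(v) = f(v *m rG g^-1), computed on formal polynomials.                *)
Definition mpoly_act (g : gT) (f : {mpoly F[n]}) : {mpoly F[n]} :=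
  f \mPo [tuple \sum_j rG g^-1%g j i *: 'X_j | i < n].

Lemma meval_mpoly_act g f (v : 'rV[F]_n) :
  (mpoly_act g f).@[v 0] = f.@[(v *m rG g^-1%g) 0].
Proof.
rewrite /mpoly_act comp_mpoly_meval; apply: meval_eq => i.
rewrite tnth_mktuple raddf_sum mxE; apply: eq_bigr => j _ /=.
by rewrite mevalZ mevalXU mulrC.
Qed.

Definition invariant (f : {mpoly F[n]}) : Prop :=
  forall g, g \in G -> mpoly_act g f = f.

(* The zero polynomial, which lies in d.-homog for every d, has no degree.    *)
Definition homog_invariant (d : nat) (f : {mpoly F[n]}) : Prop :=
  [/\ f != 0, f \is d.-homog & invariant f].

(* Independent of the chosen representative: see [frac_act_div].              *)
Definition frac_act (g : gT) (q : {fraction {mpoly F[n]}}) :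
    {fraction {mpoly F[n]}} :=
  FracField.tofrac (mpoly_act g \n_(repr q)) /
  FracField.tofrac (mpoly_act g \d_(repr q)).

Definition frac_invariant (q : {fraction {mpoly F[n]}}) : Prop :=
  forall g, g \in G -> frac_act g q = q.

Definition mx_orbit (v : 'rV[F]_n) : seq 'rV[F]_n :=
  [seq v *m rG g | g in G].

Definition G_stable (B : 'rV[F]_n -> Prop) : Prop :=
  forall g v, g \in G -> B v -> B (v *m rG g).

Definition zariski_open (B : 'rV[F]_n -> Prop) : Prop :=
  exists H : {mpoly F[n]} -> Prop,
    forall v, B v <-> exists2 h, H h & h.@[v 0] != 0.

Definition separating_on (B : 'rV[F]_n -> Prop) (S : {mpoly F[n]} -> Prop) :
    Prop :=
  forall v w, B v -> B w -> ~ (mx_orbit v =i mx_orbit w) ->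
    exists2 f, S f & f.@[v 0] <> f.@[w 0].

Definition generically_separating (S : {mpoly F[n]} -> Prop) : Prop :=
  (forall f, S f -> invariant f) /\
  exists B : 'rV[F]_n -> Prop,
    [/\ G_stable B, exists v, B v, zariski_open B & separating_on B S].

End Invariants.

(* The smallest subfield of L containing A (recall x / 0 = 0).                *)
Inductive subfield_gen (L : fieldType) (A : L -> Prop) : L -> Prop :=
| Subfield_base x of A x : subfield_gen A x
| Subfield_one : subfield_gen A 1
| Subfield_sub x y of subfield_gen A x & subfield_gen A y :
    subfield_gen A (x - y)
| Subfield_div x y of subfield_gen A x & subfield_gen A y :
    subfield_gen A (x / y).

Definition generate_invariant_field (F : fieldType) (gT : finGroupType)
    (G : {group gT}) (n : nat) (rG : mx_representation F G n)
    (S : {mpoly F[n]} -> Prop) : Prop :=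
  forall q : {fraction {mpoly F[n]}},
    frac_invariant rG q <->
    subfield_gen
      (fun x => (exists c : F, x = FracField.tofrac c%:MP) \/
                (exists2 f, S f & x = FracField.tofrac f)) q.

Section FracAct.

Variables (F : fieldType) (gT : finGroupType) (G : {group gT}) (n : nat).
Variable rG : mx_representation F G n.

Local Notation tofrac := (@FracField.tofrac {mpoly F[n]}).

Lemma mpoly_actK g : g \in G -> cancel (mpoly_act rG g) (mpoly_act rG g^-1%g).
Proof.
move=> Gg f; rewrite /mpoly_act.
set lq' := [tuple _ | i < n]; set lq := [tuple _ | i < n].
suff -> : f \mPo lq \mPo lq' = f \mPo [tuple 'X_i | i < n].
  exact: comp_mpoly_id.
rewrite [f \mPo lq]comp_mpolyEX [RHS]comp_mpolyEX raddf_sum /=; apply: eq_bigr => k _.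
rewrite comp_mpolyZ !comp_mpolyX rmorph_prod; congr (_ *: _).
apply: eq_bigr => i _ /=; rewrite rmorphXn /=; congr (_ ^+ _).
rewrite !tnth_mktuple raddf_sum /=.
transitivity (\sum_j \sum_l (rG g l j * rG g^-1%g j i) *: ('X_l : {mpoly F[n]})).
  apply: eq_bigr => j _; rewrite comp_mpolyZ comp_mpolyXU -tnth_nth.
  rewrite tnth_mktuple scaler_sumr; apply: eq_bigr => l _.
  by rewrite invgK scalerA mulrC.
have E l : \sum_j rG g l j * rG g^-1%g j i = (l == i)%:R.
  transitivity ((rG g *m rG g^-1%g) l i); first by rewrite mxE.
  by rewrite -repr_mxM ?groupV // mulgV repr_mx1 mxE.
rewrite exchange_big /= (eq_bigr (fun l => (l == i)%:R *: ('X_l : {mpoly F[n]}))).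
  rewrite (bigD1 i) //= eqxx scale1r big1 ?addr0 // => l /negbTE ->.
  exact: scale0r.
by move=> l _; rewrite -scaler_suml E.
Qed.

Lemma frac_act_div g (a b : {mpoly F[n]}) : g \in G -> b != 0 ->
  frac_act rG g (tofrac a / tofrac b) =
  tofrac (mpoly_act rG g a) / tofrac (mpoly_act rG g b).
Proof.
move=> Gg nb; rewrite /frac_act.
set q := tofrac a / tofrac b; set x := repr q.
have act0 c : c != 0 -> tofrac (mpoly_act rG g c) != 0.
  move=> nc; rewrite tofrac_eq0; apply: contraNneq nc => c0.
  by rewrite -(mpoly_actK Gg c) c0 /mpoly_act comp_mpoly0.
have nd : \d_x != 0 by apply: denom_ratioP.
have qE : q = tofrac \n_x / tofrac \d_x.
  apply: (canRL (mulfK _)); first by rewrite tofrac_eq0.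
  have -> : q = (\pi_{fraction {mpoly F[n]}} x)%qT by rewrite /x reprK.
  unlock FracField.tofrac; rewrite -[LHS]/(FracField.mul _ _) -FracField.pi_mul.
  apply/eqP; rewrite -[_ == _]/(_ == _ %[mod _])%qT FracField.equivf_def.
  rewrite /FracField.mulf !numden_Ratio ?mulr1 ?oner_eq0 //.
  by rewrite mulrC.
have e : a * \d_x = \n_x * b.
  apply/eqP; rewrite -tofrac_eq !rmorphM /= -eqr_div ?tofrac_eq0 //.
  by rewrite -/q qE.
apply/eqP; rewrite eqr_div ?act0 //= -!rmorphM /=; apply/eqP; congr tofrac.
by rewrite e.
Qed.

End FracAct.

(* Main.v *)
From HB Require Import structures.
From mathcomp Require Import zify ring.
Require Import Defs.

Set Implicit Arguments.
Unset Strict Implicit.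
Unset Printing Implicit Defensive.
Import GRing.Theory.
Local Open Scope ring_scope.

(** Let [g] generate [G] and let [A] be the matrix by which it acts on linear
forms.  Since [G] has order [p], [A - 1] is nilpotent, so an indecomposable
summand of dimension [k] is a single Jordan block: a functional that does not
kill the end of a longest Jordan chain cuts out an invariant complement to that
chain, and the complement has to vanish ([indecomposable_krylov]).  Dualising
the Jordan basis gives linear forms [x i 0, ..., x i (k i - 1)], one chain for
each summand [i], on which the generator [sigma] acts by [x i 0 |-> x i 0] and
[x i j.+1 |-> x i j.+1 + x i j].  Here [k i <= p], and the trivial summands are
those with [k i = 1].

The invariants are attached to the pairs [(i, j)] with [j < k i].
- For [j = 0], take [x i 0].
- For [j = 1] and one fixed nontrivial summand [i0], take the product of the
  translates of [y = x i0 1] by the multiples of [c = x i0 0], that is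
  [y ^+ p - y * c ^+ p.-1].
- For [j = 1] and another nontrivial summand [i], take
  [y * x i 0 - x i 1 * c].  It only has degree 2, so it is multiplied by
  [c ^+ (p - 2)], which changes neither the field generated nor the separation
  where [c] does not vanish.
- For [j >= 2], take a cubic.  Think of the chain as a series
  [X(t) = sum_j x_j t^j], so that [sigma] is multiplication by [1 + t].  The
  series [(1 + t) X'(t)] is sent to [(1 + t) ((1 + t) X'(t) + X(t))], hence
  [Z(t) = x_0 (1 + t) X'(t) - x_1 X(t)] is also multiplied by [1 + t].  The
  elements [(-1)^d sigma^d x_d] form a series that is divided by [1 + t].  The
  coefficients of the product of the last two series are invariant, and the
  one of degree [j - 1] has the shape [j x_0^2 x_j + (terms in x_l, l < j)]; as
  [j < p], the factor [j] is invertible.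

So once [y] is known, all the [x i j] can be computed one after the other from
the invariants, dividing only by the [x i 0] ([generator_solve]).  The rest
consists of two applications of this.
- Separation, where no [x i 0] vanishes: if all the invariants agree at [v] and
  [w], then [y v - y w] is [c v] times an element of the prime field.  After moving [w] by a power of the generator, [y] agrees as
  well, hence so do all coordinates ([generator_separates]).
- Field generation: let [K] be the field generated by the invariants.  Every
  polynomial is the value at [y] of some polynomial over [K] of degree less
  than [p].  If [q = P(y) / Q(y)] is invariant, then [P - q Q] vanishes at
  the [p] translates [y + d c], so it is zero, and [q] is a quotient of
  coefficients of [P] and [Q], which lie in [K]
  ([frac_invariant_subfield_gen]). *)

(** * Indecomposable modules over a nilpotent matrix *)

Section Nilpotent.

Variables (F : fieldType) (n : nat) (N : 'M[F]_n).

Lemma mulmx_exprD q (M : 'M_(q, n)) i j :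
  M *m N ^+ (i + j) = M *m N ^+ i *m N ^+ j.
Proof. by rewrite exprD -[_ * _]/(_ *m _) mulmxA. Qed.

Lemma mulmx_expr_eq0 q (M : 'M_(q, n)) k l :
  M *m N ^+ k = 0 -> (k <= l)%N -> M *m N ^+ l = 0.
Proof. by move=> Mk /subnKC <-; rewrite mulmx_exprD Mk mul0mx. Qed.

Definition krylov (u : 'rV[F]_n) k : 'M_(k, n) := \matrix_(l < k) (u *m N ^+ l).

Definition cokrylov (phi : 'cV[F]_n) k : 'M_(n, k) :=
  \matrix_(a < n, l < k) (N ^+ l *m phi) a 0.

Lemma mul_cokrylov (w : 'rV[F]_n) phi k l :
  (w *m cokrylov phi k) 0 l = (w *m (N ^+ l *m phi)) 0 0.
Proof. by rewrite !mxE; apply: eq_bigr => a _; rewrite !mxE. Qed.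

Lemma sub_krylov u k l : (l < k)%N -> (u *m N ^+ l <= krylov u k)%MS.
Proof.
by move=> lk; rewrite -(rowK (fun l : 'I_k => u *m N ^+ l) (Ordinal lk)) row_sub.
Qed.

Lemma krylov_stable u k : u *m N ^+ k = 0 -> stablemx (krylov u k) N.
Proof.
move=> uk; apply/row_subP => l; rewrite row_mul rowK -mulmxA -[_ *m N]exprSr.
have [lk|] := ltnP l.+1 k; first exact: sub_krylov.
by move=> kl; rewrite (mulmx_expr_eq0 uk kl) sub0mx.
Qed.

(** The entries [u N^(i + j) phi] of this Gram matrix vanish for [i + j > k] and
are a nonzero constant for [i + j = k]: it is anti-triangular. *)
Lemma krylov_gram_unit (u : 'rV[F]_n) (phi : 'cV[F]_n) k :
    u *m N ^+ k.+1 = 0 -> (u *m N ^+ k *m phi) 0 0 != 0 ->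
  krylov u k.+1 *m cokrylov phi k.+1 \in unitmx.
Proof.
move=> uk nz; rewrite -row_free_unit -kermx_eq0 -submx0.
apply/row_subP => i; set a := row i _.
have: a *m (krylov u k.+1 *m cokrylov phi k.+1) = 0.
  by rewrite /a -row_mul mulmx_ker row0.
rewrite mulmxA => a0; rewrite submx0; apply/eqP/rowP => j; rewrite [RHS]mxE.
have coef (l : nat) : (l < k.+1)%N ->
    \sum_(t < k.+1) a 0 t * (u *m N ^+ (t + l) *m phi) 0 0 = 0.
  move=> lk; move/rowP/(_ (Ordinal lk)): a0; rewrite mul_cokrylov [X in _ = X]mxE => e; rewrite -[RHS]e.
  rewrite mulmxA [a *m _]mulmx_sum_row !mulmx_suml summxE; apply: eq_bigr => t _.
  by rewrite rowK -!scalemxAl [RHS]mxE mulmx_exprD.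
have [q] := ubnP (j : nat); elim: q => // q IH in j *.
(* Column [k - j] isolates [a_j]: earlier coefficients are already known to be
   zero, and later rows have a vanishing entry there. *)
rewrite ltnS => jq; have jk : (k - j < k.+1)%N by rewrite ltnS leq_subr.
have := coef _ jk; rewrite (bigD1 j) //= subnKC -1?ltnS // big1 => [|t tj].
  by rewrite addr0 => /eqP; rewrite mulf_eq0 (negPf nz) orbF => /eqP.
case: (ltngtP t j) tj => [tj _|jt _|/val_inj-> /eqP//].
  by rewrite IH ?mul0r ?(leq_trans tj).
rewrite (mulmx_expr_eq0 uk) ?mul0mx ?mxE ?mulr0 //.
by have := ltn_ord j; lia.
Qed.

(** A chain of maximal length in [U], started at a row [u] with
[u N^(k - 1) <> 0], is complemented in [U] by the common kernel of the
functionals [phi, N phi, ..., N^(k - 1) phi], where [phi] does not vanish at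
[u N^(k - 1)].  Both are stable under [N], so indecomposability leaves only the
chain. *)
Lemma indecomposable_krylov p (U : 'M[F]_n) :
    N ^+ p = 0 -> stablemx U N -> U != 0 ->
    (forall U1 U2 : 'M[F]_n, stablemx U1 N -> stablemx U2 N ->
      (U1 + U2 :=: U)%MS -> mxdirect (U1 + U2) -> U1 = 0 \/ U2 = 0) ->
  exists k u, [/\ (0 < k <= p)%N, u *m N ^+ k = 0, \rank U = k
                & (U :=: krylov u k)%MS].
Proof.
move=> Np sU nzU indU.
have exk : exists k, U *m N ^+ k == 0 by exists p; rewrite Np mulmx0.
case: (ex_minnP exk) => -[|k]; first by rewrite mulmx1 (negPf nzU).
move=> /eqP Uk mink.
have kp : (k < p)%N by apply: mink; rewrite Np mulmx0.
have /matrix0Pn [i [j nz]] : U *m N ^+ k != 0.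
  by apply: contraT => /negPn/mink; rewrite ltnn.
pose u := row i U; pose phi : 'cV[F]_n := delta_mx j 0.
have uk : u *m N ^+ k.+1 = 0 by rewrite -row_mul Uk row0.
have {nz} nz : (u *m N ^+ k *m phi) 0 0 != 0.
  by rewrite -!row_mul -colE !mxE; move: nz; rewrite mxE.
have Gu := krylov_gram_unit uk nz.
set C := krylov u k.+1 in Gu; set D := cokrylov phi k.+1 in Gu.
have CU : (C <= U)%MS.
  apply/row_subP => l; rewrite rowK.
  elim: (l : nat) => [|q IH]; first by rewrite mulmx1 row_sub.
  by rewrite exprSr mulmxA; apply: submx_trans sU; apply: submxMr.
have sC' : stablemx (U :&: kermx D)%MS N.
  rewrite sub_capmx (submx_trans _ sU) ?submxMr ?capmxSl //=.
  apply/sub_kermxP/row_matrixP => a; rewrite row0 !row_mul.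
  set w := row a _; have wU : (w <= U)%MS.
    by rewrite (submx_trans (row_sub _ _)) ?capmxSl.
  have w0 : w *m D = 0.
    by apply/sub_kermxP; rewrite (submx_trans (row_sub _ _)) ?capmxSr.
  apply/rowP => l; rewrite [RHS]mxE mul_cokrylov mulmxA -(mulmxA w) -[N *m _]exprS.
  have [lk|kl] := ltnP l.+1 k.+1.
    by rewrite -mulmxA -(mul_cokrylov w phi (Ordinal lk)) w0 mxE.
  case/submxP: wU => e ->; rewrite -(mulmxA e).
  by rewrite (mulmx_expr_eq0 Uk kl) mulmx0 mul0mx mxE.
pose C1 := (<<C>>)%MS; pose C2 := (U :&: kermx D)%MS.
have dir : mxdirect (C1 + C2).
  apply/mxdirect_addsP/eqP; rewrite -submx0; apply/row_subP => a.
  set w := row a _.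
  have: (w <= C)%MS.
    by rewrite (submx_trans (row_sub _ _)) // (submx_trans (capmxSl _ _)) ?genmxE.
  have wD : w *m D = 0.
    apply/sub_kermxP; rewrite (submx_trans (row_sub _ _)) //.
    by rewrite (submx_trans (capmxSr _ _)) ?capmxSr.
  case/submxP => e we; move: wD; rewrite we -mulmxA => /(canRL (mulmxK Gu)).
  by rewrite mul0mx => ->; rewrite mul0mx submx0.
have sum : (C1 + C2 :=: U)%MS.
  apply/eqmxP; rewrite addsmx_sub genmxE CU capmxSl /=.
  (* Since [C D] is invertible, [R] is the component of [U] in the chain [C]:
     subtracting it kills all the functionals in [D]. *)
  pose R := U *m D *m invmx (C *m D) *m C.
  rewrite -[X in (X <= _)%MS](subrK R) addrC; apply: addmx_sub_adds.
    by rewrite genmxE submxMl.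
  rewrite sub_capmx addmx_sub ?eqmx_opp ?(submx_trans (submxMl _ _)) //=.
  by apply/sub_kermxP; rewrite mulmxBl /R -(mulmxA _ C) mulmxKV // subrr.
have s1 : stablemx C1 N.
  by rewrite (eqmxMr _ (genmxE _)) genmxE krylov_stable.
have rC : \rank C = k.+1.
  apply/eqP; rewrite -/(row_free C) -kermx_eq0 -submx0.
  apply/rV_subP => e /sub_kermxP eC; rewrite submx0.
  have: e *m (C *m D) = 0 by rewrite mulmxA eC mul0mx.
  by move/(canRL (mulmxK Gu)); rewrite mul0mx => ->.
have UC : (U :=: C)%MS.
  have [C10|C20] := indU _ _ s1 sC' sum dir.
    by have := genmxE C; rewrite -/C1 C10 => e; move: rC; rewrite -e mxrank0.
  by move: sum; rewrite /C2 C20 => /eqmx_sym/eqmx_trans; apply;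
     apply: eqmx_trans (addsmx0 _ _) (genmxE _).
by exists k.+1, u; split; rewrite ?UC.
Qed.

End Nilpotent.

(** * Coordinates adapted to a decomposition into Jordan blocks *)

Section DualBasis.

Variables (F : fieldType) (n : nat) (N : 'M[F]_n).

Lemma row_full_inv q (B : 'M[F]_(q, n)) : q = n -> row_full B ->
  exists C : 'M_(n, q), B *m C = 1%:M /\ C *m B = 1%:M.
Proof.
move=> e; case: _ / (esym e) B => B /row_fullP[C CB].
by exists C; split=> //; apply: mulmx1C.
Qed.

Variables (s : nat) (k : 'I_s -> nat) (u : 'I_s -> 'rV[F]_n).

(** The columns [b i j] are the basis dual to the rows [u i N^j].  They are
indexed by natural numbers, so only the values with [j < k i] are meaningful,
and independence and generation are stated in the form in which they are used:
prescribing coordinates, and expanding a linear form. *)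
Lemma dual_jordan_basis :
    (forall i, u i *m N ^+ k i = 0) ->
    (1%:M <= \sum_i <<krylov N (u i) (k i)>>)%MS ->
    (\sum_i k i)%N = n ->
  exists b : 'I_s -> nat -> 'cV[F]_n,
    [/\ forall i, N *m b i 0%N = 0,
        forall i j, (j.+1 < k i)%N -> N *m b i j.+1 = b i j,
        forall c : 'I_s -> nat -> F, exists v : 'rV_n,
          forall i j, (j < k i)%N -> (v *m b i j) 0 0 = c i j
      & forall c : 'cV_n, exists a : 'I_s -> nat -> F,
          c = \sum_i \sum_(j < k i) a i j *: b i j].
Proof.
move=> uk full sum_k; pose T : finType := {i : 'I_s & 'I_(k i)}.
pose B : 'M_(#|T|, n) := \matrix_(t < #|T|)
  (u (tag (enum_val t)) *m N ^+ tagged (enum_val t)).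
have cardT : #|T| = n.
  by rewrite card_tagged sumnE big_map big_enum -sum_k; apply: eq_bigr => i _;
     rewrite card_ord.
have rowB (t : T) : row (enum_rank t) B = u (tag t) *m N ^+ tagged t.
  by rewrite rowK enum_rankK.
have [|C [BC CB]] := row_full_inv cardT (_ : row_full B).
  rewrite -sub1mx (submx_trans full) //; apply/sumsmx_subP => i _.
  rewrite genmxE; apply/row_subP => l; rewrite rowK.
  by rewrite -(rowB (Tagged _ l)) row_sub.
(* Out of range, [b i j] is 0; this makes [N b i 0 = 0] hold even if [k i = 0]. *)
pose b (i : 'I_s) (j : nat) : 'cV_n :=
  if (insub j : option 'I_(k i)) is Some l then col (enum_rank (Tagged (fun i => 'I_(k i)) l)) C
  else 0 : 'cV_n.
have bE i (l : 'I_(k i)) : b i l = col (enum_rank (Tagged _ l)) C.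
  by rewrite /b valK.
have bdual (t : T) i j : (j < k i)%N ->
    (u (tag t) *m N ^+ tagged t *m b i j) 0 0 =
    ((tag t == i) && (tagged t == j :> nat))%:R.
  move=> ji; rewrite -(rowB t) (bE i (Ordinal ji)) -row_mul colE mulmxA BC.
  rewrite mul1mx !mxE eqxx andbT (inj_eq enum_rank_inj) -tag_eqE /tag_eq /=.
  have [|//] := eqVneq (tag t) i; case: t => a l /= e; case: _ / e ji => ji.
  by rewrite tagged_asE.
have ext (x y : 'cV_n) : (forall t : T, (u (tag t) *m N ^+ tagged t *m x) 0 0 =
    (u (tag t) *m N ^+ tagged t *m y) 0 0) -> x = y.
  move=> xy; rewrite -(mul1mx x) -(mul1mx y) -CB -!mulmxA; congr (_ *m _).
  apply/colP => t; have := xy (enum_val t).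
  by rewrite -rowB enum_valK -!row_mul ![row _ _ _ _]mxE.
have ukS (t : T) x : (u (tag t) *m N ^+ tagged t *m (N *m x)) 0 0 =
    (u (tag t) *m N ^+ (tagged t).+1 *m x) 0 0.
  by rewrite mulmxA -(mulmxA (u _)) -[_ *m N]exprSr.
exists b; split=> [i|i j ji|c|c].
- apply: ext => t; rewrite ukS mulmx0 [RHS]mxE.
  have [lt|] := ltnP (tagged t).+1 (k (tag t)); last first.
    by move=> /(mulmx_expr_eq0 (uk (tag t)))->; rewrite mul0mx mxE.
  have [ki|] := ltnP 0 (k i).
    by rewrite (bdual (Tagged _ (Ordinal lt))) //= andbF.
  by rewrite /b leqn0 => /eqP ki; rewrite insubF ?ki // mulmx0 mxE.
- apply: ext => t; rewrite ukS.
  have [lt|] := ltnP (tagged t).+1 (k (tag t)).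
    by rewrite (bdual (Tagged _ (Ordinal lt))) // bdual ?(ltnW ji).
  move=> kt; rewrite (mulmx_expr_eq0 (uk (tag t)) kt) mul0mx mxE bdual ?(ltnW ji) //.
  case: eqP => //= ti; case: eqP => // tj; by move: ji kt; rewrite -ti -tj ltnNge => /negPf->.
- exists ((\row_(t < #|T|) c (tag (enum_val t)) (tagged (enum_val t) : 'I__)) *m B) => i j ji.
  rewrite (bE i (Ordinal ji)) colE -mulmxA (mulmxA B) BC mul1mx -colE.
  by rewrite !mxE enum_rankK.
pose a (i : 'I_s) (j : nat) := if (insub j : option 'I_(k i)) is Some l
  then (B *m c) (enum_rank (Tagged (fun i => 'I_(k i)) l)) 0 else 0.
exists a; rewrite -[LHS]mul1mx -CB -mulmxA.
rewrite (sig_big_dep (fun _ => true)) /=.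
apply/colP => r; rewrite mxE summxE (reindex (@enum_rank T)) /=;
  last exact/onW_bij/enum_rank_bij.
apply: eq_bigr => -[i l] _ /=.
by rewrite bE /a valK [RHS]mxE mulrC [col _ _ _ _]mxE.
Qed.

End DualBasis.

(** The chains run in the direction opposite to those of the vectors: [b i 0] is
the fixed functional, and the last one, [b i (k i - 1)], generates. *)
Definition jordan_coordinates (F : fieldType) (n : nat) (N : 'M[F]_n) s
    (k : 'I_s -> nat) (b : 'I_s -> nat -> 'cV[F]_n) : Prop :=
  [/\ forall i, N *m b i 0%N = 0,
      forall i j, (j.+1 < k i)%N -> N *m b i j.+1 = b i j,
      forall c : 'I_s -> nat -> F, exists v : 'rV_n,
        forall i j, (j < k i)%N -> (v *m b i j) 0 0 = c i j
    & forall c : 'cV_n, exists a : 'I_s -> nat -> F,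
        c = \sum_i \sum_(j < k i) a i j *: b i j].

(** * Jordan blocks of a representation of a cyclic group of order p *)

Section Representation.

Variables (F : fieldType) (gT : finGroupType) (G : {group gT}) (n : nat).
Variables (rG : mx_representation F G n) (h : gT) (p : nat).
Hypotheses (genG : G :=: <[h]>%g) (oG : #|G| = p) (chF : p \in [pchar F]).

Local Notation N := (rG h - 1%:M).

Let Gh : h \in G. Proof. by rewrite genG cycle_id. Qed.

Lemma repr_generator_unipotent : N ^+ p = 0.
Proof.
clear - Gh oG chF; case: n rG => [|n'] rG'; first by apply/matrixP => -[].
have chM : p \in [pchar 'M[F]_n'.+1] by rewrite pchar_lalg.
rewrite -(pFrobenius_autE chM) pFrobenius_autB_comm; last exact: commr1.
rewrite pFrobenius_aut1 pFrobenius_autE -repr_mxX // -oG.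
by rewrite expg_cardG // repr_mx1 subrr.
Qed.

Lemma mxmodule_generator (U : 'M[F]_n) : mxmodule rG U = stablemx U N.
Proof.
rewrite /mxmodule [in X in X \subset _]genG cycle_subG inE Gh /=.
apply/idP/idP => [Uh|UN].
  by rewrite mulmxBr mulmx1 addmx_sub ?eqmx_opp.
by rewrite -[rG h](subrK 1%:M) mulmxDr mulmx1 addmx_sub.
Qed.

Lemma rfix_generator q (M : 'M[F]_(q, n)) :
  (M <= rfix_mx rG G)%MS = (M *m N == 0).
Proof.
rewrite -rfix_mx_rstabC // [in X in X \subset _]genG cycle_subG inE Gh /=.
by rewrite mulmxBr mulmx1 subr_eq0.
Qed.

Lemma indecomposable_jordan_coordinates s (W : 'I_s -> 'M[F]_n) :
    indecomposable_decomposition rG W ->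
  exists k b, [/\ forall i, (0 < k i <= p)%N, (\sum_i k i)%N = n,
    forall i, trivial_summand rG (W i) = (k i == 1)%N
    & jordan_coordinates N k b].
Proof.
case=> indW sumW dirW.
have kuP i : exists ku : nat * 'rV[F]_n, [/\ (0 < ku.1 <= p)%N,
    ku.2 *m N ^+ ku.1 = 0, \rank (W i) = ku.1 & (W i :=: krylov N ku.2 ku.1)%MS].
  have [modW nzW indWi] := indW i; rewrite mxmodule_generator in modW.
  have [|k [u [? ? ? ?]]] := indecomposable_krylov repr_generator_unipotent modW nzW.
    by move=> U1 U2 s1 s2; apply: indWi; rewrite mxmodule_generator.
  by exists (k, u).
have [ku kuE] := fin_all_exists kuP.
have sum_k : (\sum_i (ku i).1)%N = n.
  apply/esym; have := mxdirectP dirW; rewrite /= sumW mxrank1 => e; rewrite [LHS]e.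
  by apply: eq_bigr => i _; have [_ _ -> _] := kuE i.
have [|| |b bP] := @dual_jordan_basis _ _ N _ (fun i => (ku i).1)
    (fun i => (ku i).2).
- by move=> i; have [] := kuE i.
- rewrite -sumW; apply/sumsmx_subP => i _; rewrite (sumsmx_sup i) // genmxE.
  by have [_ _ _ ->] := kuE i.
- exact: sum_k.
exists (fun i => (ku i).1), b; split=> // i; have [k0 uk rW eW] := kuE i => //.
rewrite /trivial_summand rW; apply: andb_idr => /eqP k1.
rewrite rfix_generator -submx0 (eqmxMr _ eW) submx0; apply/eqP.
apply/row_matrixP => l; rewrite row0 row_mul rowK.
have -> : l = 0%N :> nat by apply/eqP; rewrite -leqn0 -ltnS (leq_trans (ltn_ord l)) ?k1.
by move: uk; rewrite k1 mulmx1 expr1.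
Qed.

(** A vector is fixed exactly when all its coordinates [b i j] with
[j + 1 < k i] vanish, so the [s] top coordinates identify the fixed space with
['rV_s]. *)
Lemma rank_rfix_jordan s (k : 'I_s -> nat) b : (forall i, 0 < k i)%N ->
  jordan_coordinates N k b -> \rank (rfix_mx rG G) = s.
Proof.
move=> k0 [b0 bS b_free b_gen].
have eqv (v w : 'rV[F]_n) :
    (forall i j, (j < k i)%N -> (v *m b i j) 0 0 = (w *m b i j) 0 0) -> v = w.
  move=> vw; apply/rowP => a; have [c ec] := b_gen (delta_mx a 0).
  have vE (x : 'rV[F]_n) : x 0 a = (x *m delta_mx a 0 : 'cV_1) 0 0.
    by rewrite -colE mxE.
  rewrite !vE ec !mulmx_sumr !summxE; apply: eq_bigr => i _.
  rewrite !mulmx_sumr !summxE; apply: eq_bigr => j _.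
  by rewrite -!scalemxAr mxE [RHS]mxE vw.
pose D : 'M[F]_(n, s) := \matrix_(a < n, i < s) b i (k i).-1 a 0.
have mulD (v : 'rV_n) i : (v *m D) 0 i = (v *m b i (k i).-1) 0 0.
  by rewrite !mxE; apply: eq_bigr => a _; rewrite !mxE.
have tk i : ((k i).-1 < k i)%N by rewrite prednK.
have -> : \rank (rfix_mx rG G) = \rank (rfix_mx rG G *m D).
  apply/esym/eqP; rewrite -(mxrank_mul_ker (rfix_mx rG G) D) -[X in X == _]addn0 eqn_add2l.
  rewrite eq_sym mxrank_eq0 -submx0; apply/rV_subP => v.
  rewrite sub_capmx rfix_generator => /andP[/eqP vN /sub_kermxP vD].
  rewrite submx0; apply/eqP/eqv => i j ji; rewrite mul0mx [RHS]mxE.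
  have [jt|] := ltnP j.+1 (k i).
    by rewrite -bS // mulmxA vN mul0mx mxE.
  move=> kj; have -> : j = (k i).-1 by clear - ji kj; lia.
  by rewrite -mulD vD mxE.
apply/eqP; rewrite -/(row_full _) -sub1mx; apply/row_subP => i0.
have [v vP] := b_free (fun i j => ((i == i0) && (j == (k i).-1))%:R).
have vfix : (v <= rfix_mx rG G)%MS.
  rewrite rfix_generator; apply/eqP/eqv => i [|j] ji; rewrite -mulmxA.
    by rewrite b0 mulmx0 mul0mx.
  rewrite bS // vP ?(ltnW ji) // mul0mx mxE.
  have -> : (j == (k i).-1) = false by apply/eqP; clear - ji; lia.
  by rewrite andbF.
have -> : row i0 1%:M = v *m D by
  apply/rowP => i; rewrite mulD vP ?tk // !mxE eqxx andbT eq_sym.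
exact: submxMr.
Qed.

End Representation.

(** * Invariants of a chain in a ring with an endomorphism *)

(** Subrings as propositional predicates: those needed below, such as taking the
same value at two points or lying in the field generated by some set, have no
decision procedure. *)
Definition subring_pred (R : nzRingType) (Q : R -> Prop) : Prop :=
  [/\ Q 1, forall f g, Q f -> Q g -> Q (f - g)
    & forall f g, Q f -> Q g -> Q (f * g)].

Section SubringPred.

Variables (R : nzRingType) (Q : R -> Prop).
Hypothesis Qring : subring_pred Q.

Lemma subring_pred0 : Q 0.
Proof. by have [Q1 QB _] := Qring; rewrite -(subrr 1); apply: QB. Qed.

Lemma subring_predB f g : Q f -> Q g -> Q (f - g).
Proof. by have [_ QB _] := Qring; apply: QB. Qed.

Lemma subring_predM f g : Q f -> Q g -> Q (f * g).
Proof. by have [_ _ QM] := Qring; apply: QM. Qed.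

Lemma subring_predN f : Q f -> Q (- f).
Proof. by rewrite -sub0r; apply: subring_predB; apply: subring_pred0. Qed.

Lemma subring_predD f g : Q f -> Q g -> Q (f + g).
Proof.
by move=> Qf Qg; rewrite -[g]opprK; apply: subring_predB => //; apply: subring_predN.
Qed.

Lemma subring_predMn f m : Q f -> Q (f *+ m).
Proof.
move=> Qf; elim: m => [|m IH]; first exact: subring_pred0.
by rewrite mulrS; apply: subring_predD.
Qed.

Lemma subring_predX f m : Q f -> Q (f ^+ m).
Proof.
move=> Qf; elim: m => [|m IH]; first by have [] := Qring.
by rewrite exprS; apply: subring_predM.
Qed.

Lemma subring_pred_sum (I : finType) (P : pred I) (E : I -> R) :
  (forall i, P i -> Q (E i)) -> Q (\sum_(i | P i) E i).
Proof.
move=> QE; apply: (big_ind Q) => //; first exact: subring_pred0.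
by move=> *; apply: subring_predD.
Qed.

End SubringPred.

Section Chain.

Variables (R : comNzRingType) (sigma : {rmorphism R -> R}).
Implicit Types (a b x : nat -> R).

(** If [sigma] multiplies the series of [b] by [1 + t] and divides that of [a] by
[1 + t], then it fixes the coefficients of the product of the two series. *)
Lemma convolution_fixed a b d :
    sigma (a 0%N) = a 0%N -> sigma (b 0%N) = b 0%N ->
    (forall l, (l < d)%N -> sigma (a l.+1) + sigma (a l) = a l.+1) ->
    (forall l, (l < d)%N -> sigma (b l.+1) = b l.+1 + b l) ->
  sigma (\sum_(l < d.+1) a (d - l)%N * b l) = \sum_(l < d.+1) a (d - l)%N * b l.
Proof.
move=> a0 b0 aS bS; rewrite rmorph_sum big_ord_recl /= rmorphM b0 /=.
have -> : \sum_(l < d) sigma (a (d - bump 0 l)%N * b (bump 0 l)) =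
    \sum_(l < d) sigma (a (d - l.+1)%N) * b l.+1 +
    \sum_(l < d) sigma (a (d - l.+1)%N) * b l.
  by rewrite -big_split; apply: eq_bigr => l _; rewrite /= rmorphM /= bS // mulrDr.
have -> : sigma (a (d - 0)%N) * b 0%N + (\sum_(l < d) sigma (a (d - l.+1)%N) * b l.+1
    + \sum_(l < d) sigma (a (d - l.+1)%N) * b l) =
    \sum_(l < d.+1) sigma (a (d - l)%N) * b l +
    \sum_(l < d) sigma (a (d - l.+1)%N) * b l.
  by rewrite addrA [in RHS]big_ord_recl.
rewrite big_ord_recr /= subnn a0 addrAC -big_split /= [in RHS]big_ord_recr /= subnn.
congr (_ + _); apply: eq_bigr => l _.
by have ld := ltn_ord l; rewrite -mulrDl -(subnSK ld) aS //; lia.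
Qed.

(** As [sigma x_(d+1) - x_(d+1) = x_d], these elements form a chain for the
inverse of [sigma]: their series is divided by [1 + t]. *)
Definition opposite_chain x d := (-1) ^+ d * iter d sigma (x d).

(** The coefficient of [t^l] in [x_0 (1 + t) X'(t) - x_1 X(t)], where
[X(t) = sum_j x_j t^j]; the multiple of [x_0 X(t)] that [sigma] adds to the first
term is cancelled by the change of [x_1] in the second. *)
Definition wronskian_chain x l :=
  x 0%N * (l.+1%:R * x l.+1 + l%:R * x l) - x 1%N * x l.

Definition cubic_invariant x j :=
  \sum_(l < j) opposite_chain x (j.-1 - l)%N * wronskian_chain x l.

Definition quadratic_invariant x y := x 1%N * y 0%N - y 1%N * x 0%N.

(** In characteristic [p], the product of the translates [x_1 + d x_0] for [d] in
the prime field. *)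
Definition norm_invariant p x := x 1%N ^+ p - x 1%N * x 0%N ^+ p.-1.

Variables (x : nat -> R) (k : nat).
Hypotheses (x0 : sigma (x 0%N) = x 0%N)
  (xS : forall j, (j.+1 < k)%N -> sigma (x j.+1) = x j.+1 + x j).

Lemma iter_rmorphD m f g : iter m sigma (f + g) = iter m sigma f + iter m sigma g.
Proof. by elim: m => //= m ->; rewrite rmorphD. Qed.

Lemma opposite_chainS d : (d.+1 < k)%N ->
  sigma (opposite_chain x d.+1) + sigma (opposite_chain x d) =
  opposite_chain x d.+1.
Proof.
move=> dk; rewrite /opposite_chain !rmorphM !rmorphXn !rmorphN1 /=.
have E : sigma (iter d sigma (x d.+1)) = iter d sigma (x d.+1) + iter d sigma (x d).
  by rewrite -iterS iterSr xS // iter_rmorphD.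
by rewrite !E rmorphD /= !E exprS; ring.
Qed.

Lemma wronskian_chainS l : (l.+2 < k)%N ->
  sigma (wronskian_chain x l.+1) = wronskian_chain x l.+1 + wronskian_chain x l.
Proof.
move=> lk; rewrite /wronskian_chain.
rewrite rmorphB !rmorphM rmorphD !rmorphM !rmorph_nat.
by rewrite x0 !xS //; [ring | lia..].
Qed.

Lemma wronskian_chain0 : wronskian_chain x 0 = 0.
Proof. by rewrite /wronskian_chain; ring. Qed.

Lemma cubic_invariant_fixed j : (0 < j < k)%N ->
  sigma (cubic_invariant x j) = cubic_invariant x j.
Proof.
case: j => // d /= dk; apply: convolution_fixed => [||l ld|l ld].
- by rewrite /opposite_chain /= mul1r.
- by rewrite wronskian_chain0 rmorph0.
- by apply: opposite_chainS; lia.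
- by apply: wronskian_chainS; lia.
Qed.

(** The property [Q] stands for membership in the subring generated by
[x_0, ..., x_(j-1)].  Only the last summand of the cubic involves [x_j], with
coefficient [x_0 * (x_0 * j)]. *)
Lemma cubic_invariant_leading (Q : R -> Prop) j : (1 < j < k)%N ->
    subring_pred Q -> (forall l, (l < j)%N -> Q (x l)) ->
  Q (cubic_invariant x j - x 0%N ^+ 2 * x j *+ j).
Proof.
case: j => // d /andP[d0 dk] Qring Qx.
have Qiter e l : (l < d.+1)%N -> Q (iter e sigma (x l)).
  elim: e l => [|e IH] l ld; first exact: Qx.
  rewrite iterSr; case: l ld => [|l] ld; first by rewrite x0; apply: IH.
  rewrite xS; last lia.
  by rewrite iter_rmorphD; apply: subring_predD => //; apply: IH => //; lia.
have Qopp l : (l < d.+1)%N -> Q (opposite_chain x l).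
  move=> ld; apply: subring_predM => //; last exact: Qiter.
  by apply: subring_predX => //; apply: subring_predN => //; have [] := Qring.
rewrite /cubic_invariant big_ord_recr /= subnn -addrA.
apply: subring_predD => //; first apply: subring_pred_sum => // l _.
  apply: subring_predM => //; first by apply: Qopp; rewrite ltnS leq_subr.
  have ld := ltn_ord l; rewrite /wronskian_chain.
  have [Q1 _ _] := Qring.
  have Qnat m : Q m%:R by apply: subring_predMn.
  apply: subring_predB => //; apply: subring_predM => //; try by apply: Qx; lia.
  by apply: subring_predD => //; apply: subring_predM => //; apply: Qx; lia.
rewrite (_ : _ - _ = x 0%N * (x 0%N * (d%:R * x d) - x 1%N * x d)); last first.
  by rewrite /opposite_chain /wronskian_chain /= -mulr_natl; ring.
have [Q1 _ _] := Qring.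
apply: subring_predM; rewrite //; first by apply: Qx.
by apply: subring_predB => //; do !apply: subring_predM => //; try exact: Qx;
   apply: subring_predMn.
Qed.

Lemma norm_invariant_fixed p : p \in [pchar R] -> (1 < k)%N ->
  sigma (norm_invariant p x) = norm_invariant p x.
Proof.
move=> chR k1; have p0 := prime_gt0 (pcharf_prime chR).
rewrite /norm_invariant rmorphB rmorphM !rmorphXn /= x0 xS //.
rewrite -!(pFrobenius_autE chR) pFrobenius_autD_comm; last exact: mulrC.
by rewrite mulrDl -exprS prednK // !pFrobenius_autE; ring.
Qed.

Lemma quadratic_invariant_fixed y k' : sigma (y 0%N) = y 0%N ->
    (forall j, (j.+1 < k')%N -> sigma (y j.+1) = y j.+1 + y j) ->
    (1 < k)%N -> (1 < k')%N ->
  sigma (quadratic_invariant x y) = quadratic_invariant x y.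
Proof.
move=> y0 yS k1 k1'; rewrite /quadratic_invariant rmorphB !rmorphM /= x0 y0.
by rewrite xS // yS //; ring.
Qed.

End Chain.

(** * Linear forms and the action on polynomials and fractions *)

Section LinearForms.

Variables (F : fieldType) (n : nat).
Implicit Types (c d : 'cV[F]_n) (v : 'rV[F]_n).

Definition linear_form c : {mpoly F[n]} := \sum_i c i 0 *: 'X_i.

Lemma linear_formD c d : linear_form (c + d) = linear_form c + linear_form d.
Proof.
by rewrite -big_split; apply: eq_bigr => i _; rewrite mxE scalerDl.
Qed.

Lemma linear_formZ a c : linear_form (a *: c) = a%:MP * linear_form c.
Proof.
by rewrite mul_mpolyC scaler_sumr; apply: eq_bigr => i _; rewrite mxE scalerA.
Qed.

Lemma linear_form0 : linear_form 0 = 0.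
Proof. by apply: big1 => i _; rewrite mxE scale0r. Qed.

Lemma linear_form_sum (I : Type) (r : seq I) (P : pred I) (E : I -> 'cV[F]_n) :
  linear_form (\sum_(i <- r | P i) E i) = \sum_(i <- r | P i) linear_form (E i).
Proof. exact: (big_morph linear_form linear_formD linear_form0). Qed.

Lemma linear_form_delta i : linear_form (delta_mx i 0) = 'X_i.
Proof.
rewrite /linear_form (bigD1 i) //= mxE !eqxx scale1r big1 ?addr0 // => j ji.
by rewrite mxE (negPf ji) scale0r.
Qed.

Lemma meval_linear_form c v : (linear_form c).@[v 0] = (v *m c) 0 0.
Proof.
rewrite raddf_sum mxE; apply: eq_bigr => i _ /=.
by rewrite mevalZ mevalXU mulrC.
Qed.

Lemma linear_form_homog c : linear_form c \is 1.-homog.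
Proof.
by apply: rpred_sum => i _; rewrite rpredZ // dhomogX /= mdeg1.
Qed.

Lemma mpoly_subring_ind (Q : {mpoly F[n]} -> Prop) :
    subring_pred Q -> (forall a, Q a%:MP) -> (forall c, Q (linear_form c)) ->
  forall f, Q f.
Proof.
move=> Qring QC QL f; rewrite (mpolyE f); apply: (big_ind Q) => [||m _].
- exact: subring_pred0.
- by move=> *; apply: subring_predD.
rewrite -mul_mpolyC mpolyXE_id; apply: subring_predM => //.
apply: (big_ind Q) => [||i _]; first by have [] := Qring.
  by move=> *; apply: subring_predM.
by apply: subring_predX => //; rewrite -linear_form_delta.
Qed.

End LinearForms.

Section Action.

Variables (F : fieldType) (gT : finGroupType) (G : {group gT}) (n : nat).
Variable rG : mx_representation F G n.

Definition mpoly_act_rmorphism g : {rmorphism {mpoly F[n]} -> {mpoly F[n]}} :=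
  comp_mpoly [tuple \sum_j rG g^-1%g j i *: 'X_j | i < n].

Lemma mpoly_actE g f : mpoly_act rG g f = mpoly_act_rmorphism g f.
Proof. by []. Qed.

Lemma mpoly_act_linear_form g c :
  mpoly_act rG g (linear_form c) = linear_form (rG g^-1%g *m c).
Proof.
rewrite /mpoly_act raddf_sum /=.
under eq_bigr => i _ do rewrite comp_mpolyZ comp_mpolyXU -tnth_nth tnth_mktuple
  scaler_sumr.
rewrite exchange_big; apply: eq_bigr => j _ /=; rewrite mxE scaler_suml.
by apply: eq_bigr => i _; rewrite scalerA mulrC.
Qed.

Lemma mpoly_act_one g : mpoly_act rG g 1 = 1.
Proof. exact: (rmorph1 (mpoly_act_rmorphism g)). Qed.

Lemma mpoly_act_sub g f h :
  mpoly_act rG g (f - h) = mpoly_act rG g f - mpoly_act rG g h.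
Proof. exact: (rmorphB (mpoly_act_rmorphism g)). Qed.

Lemma mpoly_act_mul g f h :
  mpoly_act rG g (f * h) = mpoly_act rG g f * mpoly_act rG g h.
Proof. exact: (rmorphM (mpoly_act_rmorphism g)). Qed.

Lemma mpoly_actC g a : mpoly_act rG g a%:MP = a%:MP.
Proof. exact: comp_mpolyC. Qed.

Lemma mpoly_actM g1 g2 f : g1 \in G -> g2 \in G ->
  mpoly_act rG (g1 * g2)%g f = mpoly_act rG g2 (mpoly_act rG g1 f).
Proof.
move=> G1 G2; move: f; apply: mpoly_subring_ind; first split.
- by rewrite !mpoly_act_one.
- by move=> f h; rewrite !mpoly_act_sub => -> ->.
- by move=> f h; rewrite !mpoly_act_mul => -> ->.
- by move=> a; rewrite !mpoly_actC.
by move=> c; rewrite !mpoly_act_linear_form invMg repr_mxM ?groupV // mulmxA.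
Qed.

Lemma mpoly_act1 f : mpoly_act rG 1%g f = f.
Proof.
move: f; apply: mpoly_subring_ind; first split.
- by rewrite !mpoly_act_one.
- by move=> f h; rewrite !mpoly_act_sub => -> ->.
- by move=> f h; rewrite !mpoly_act_mul => -> ->.
- by move=> a; rewrite !mpoly_actC.
by move=> c; rewrite mpoly_act_linear_form invg1 repr_mx1 mul1mx.
Qed.

Lemma mpoly_actX g d f : g \in G ->
  mpoly_act rG (g ^+ d)%g f = iter d (mpoly_act rG g) f.
Proof.
move=> Gg; elim: d => [|d IH]; first exact: mpoly_act1.
by rewrite expgSr mpoly_actM ?groupX // IH.
Qed.

Lemma invariant_generator g f : G :=: <[g]>%g ->
  mpoly_act rG g f = f -> invariant rG f.
Proof.
move=> genG gf h; rewrite [in h \in _]genG => /cycleP[d ->].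
by rewrite mpoly_actX ?genG ?cycle_id //; elim: d => //= d ->.
Qed.

Lemma invariant_meval f h (v : 'rV_n) : invariant rG f -> h \in G ->
  f.@[(v *m rG h) 0] = f.@[v 0].
Proof.
by move=> fG Gh; rewrite -{2}(fG h^-1%g) ?groupV // meval_mpoly_act invgK.
Qed.

End Action.

Section FractionAction.

Variables (F : fieldType) (gT : finGroupType) (G : {group gT}) (n : nat).
Variable rG : mx_representation F G n.

Local Notation L := {fraction {mpoly F[n]}}.
Local Notation tofrac := (@FracField.tofrac {mpoly F[n]}).

Lemma fraction_div (q : L) : exists a b, b != 0 /\ q = tofrac a / tofrac b.
Proof.
exists \n_(repr q), \d_(repr q); have nd := denom_ratioP (repr q).
split=> //; apply: (canRL (mulfK _)); first by rewrite tofrac_eq0.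
have {1}-> : q = (\pi_{fraction {mpoly F[n]}} (repr q))%qT by rewrite reprK.
set x := repr q in nd *.
unlock FracField.tofrac; rewrite -[LHS]/(FracField.mul _ _) -FracField.pi_mul.
apply/eqP; rewrite -[_ == _]/(_ == _ %[mod _])%qT FracField.equivf_def.
rewrite /FracField.mulf !numden_Ratio ?mulr1 ?oner_eq0 //.
by rewrite mulrC.
Qed.

Variables (h : gT) (Gh : h \in G).

Lemma frac_act_tofrac f : frac_act rG h (tofrac f) = tofrac (mpoly_act rG h f).
Proof.
rewrite -[tofrac f]divr1 -(rmorph1 tofrac) frac_act_div ?oner_eq0 //.
by rewrite mpoly_act_one rmorph1 divr1.
Qed.

Let act_neq0 f : f != 0 -> tofrac (mpoly_act rG h f) != 0.
Proof.
move=> f0; rewrite tofrac_eq0; apply: contraNneq f0 => e.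
by rewrite -(mpoly_actK rG Gh f) e mpoly_actE rmorph0.
Qed.

Lemma frac_act_zmod_morphism : zmod_morphism (frac_act rG h).
Proof.
move=> x y; have [a [b [b0 ->]]] := fraction_div x.
have [c [d [d0 ->]]] := fraction_div y.
rewrite -mulNr addf_div ?tofrac_eq0 // mulNr -!rmorphM -rmorphB /=.
rewrite !frac_act_div ?mulf_neq0 // mpoly_act_sub !mpoly_act_mul rmorphB !rmorphM /=.
by rewrite -[X in _ = _ + X]mulNr addf_div ?act_neq0 // mulNr.
Qed.

Lemma frac_act_monoid_morphism : monoid_morphism (frac_act rG h).
Proof.
split=> [|x y]; first by rewrite -(rmorph1 tofrac) frac_act_tofrac mpoly_act_one.
have [a [b [b0 ->]]] := fraction_div x.
have [c [d [d0 ->]]] := fraction_div y.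
rewrite mulf_div -!rmorphM !frac_act_div ?mulf_neq0 // !mpoly_act_mul !rmorphM /=.
by rewrite mulf_div.
Qed.

Definition frac_act_rmorphism : {rmorphism L -> L} :=
  HB.pack (frac_act rG h)
    (GRing.isZmodMorphism.Build L L (frac_act rG h) frac_act_zmod_morphism)
    (GRing.isMonoidMorphism.Build L L (frac_act rG h) frac_act_monoid_morphism).

Lemma frac_act_rmorphismE : frac_act rG h =1 frac_act_rmorphism.
Proof. by []. Qed.

End FractionAction.

Section SubfieldGen.

Variables (L : fieldType) (A : L -> Prop).

Lemma subfield_gen_subring : subring_pred (subfield_gen A).
Proof.
split=> [|x y|x y Ax Ay]; [exact: Subfield_one | exact: Subfield_sub |].
rewrite -[y]invrK -[y^-1]div1r.
by apply: Subfield_div Ax _; apply: Subfield_div Ay; apply: Subfield_one.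
Qed.

End SubfieldGen.

(** * Translates by the prime field *)

Section PrimeField.

Variables (L : fieldType) (p : nat).
Hypothesis chL : p \in [pchar L].

Lemma natr_pchar_inj d e : (d < p)%N -> (e < p)%N -> d%:R = e%:R :> L -> d = e.
Proof.
wlog le_de : d e / (d <= e)%N => [W dp ep de|].
  by have [le|/ltnW le] := leqP d e; [apply: W | apply/esym/W].
move=> dp ep /esym/eqP; rewrite -subr_eq0 -natrB // -(dvdn_pcharf chL).
move=> p_de; have [lt|] := ltnP 0 (e - d); last by lia.
by move: p_de; rewrite gtnNdvd //; lia.
Qed.

Lemma uniq_translates (y c : L) : c != 0 ->
  uniq [seq y + c *+ d | d <- iota 0 p].
Proof.
move=> c0; rewrite map_inj_in_uniq ?iota_uniq // => d e; rewrite !mem_iota !add0n.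
move=> dp ep /addrI; rewrite -mulr_natr -[in RHS]mulr_natr => /(mulfI c0).
exact: natr_pchar_inj.
Qed.

Lemma poly_eq0_translates (P : {poly L}) y c : c != 0 -> (size P <= p)%N ->
  (forall d, (d < p)%N -> P.[y + c *+ d] = 0) -> P = 0.
Proof.
move=> c0 sP rP; apply: (@roots_geq_poly_eq0 _ _ [seq y + c *+ d | d <- iota 0 p]).
- by apply/allP => _ /mapP[d + ->]; rewrite mem_iota => dp; rewrite rootE rP.
- exact: uniq_translates.
- by rewrite size_map size_iota.
Qed.

(** The equation [T^p - c^(p-1) T = z^p - c^(p-1) z] has the [p] roots [z + d c],
hence no other. *)
Lemma artin_schreier_root (y z c : L) : c != 0 ->
    y ^+ p - y * c ^+ p.-1 = z ^+ p - z * c ^+ p.-1 ->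
  exists d, y = z + c *+ d.
Proof.
move=> c0 yz; have p0 := prime_gt0 (pcharf_prime chL).
have [/mapP[d _ ->]|nd] := boolP (y \in [seq z + c *+ d | d <- iota 0 p]).
  by exists d.
pose P : {poly L} := 'X^p - (c ^+ p.-1 *: 'X + (z ^+ p - z * c ^+ p.-1)%:P).
have sP : size P = p.+1.
  rewrite size_polyDl size_polyXn // size_polyN ltnS.
  rewrite (leq_trans (size_polyD _ _)) // geq_max (leq_trans (size_scale_leq _ _)).
    by rewrite (leq_trans (size_polyC_leq1 _)).
  by rewrite size_polyX prime_gt1 // (pcharf_prime chL).
have: P = 0.
  apply: (@roots_geq_poly_eq0 _ _ (y :: [seq z + c *+ d | d <- iota 0 p])).
  - rewrite /= rootE !(hornerD, hornerN, hornerXn, hornerZ, hornerX, hornerC) -yz.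
    apply/andP; split; first by apply/eqP; ring.
    apply/allP => _ /mapP[d _ ->]; rewrite rootE !(hornerD, hornerN, hornerXn, hornerZ, hornerX, hornerC).
    rewrite -!(pFrobenius_autE chL) pFrobenius_autD_comm ?pFrobenius_autMn;
      last exact: mulrC.
    by rewrite mulrDr mulrnAr -exprSr prednK // !pFrobenius_autE; apply/eqP; ring.
  - by rewrite /= nd uniq_translates.
  - by rewrite /= size_map size_iota sP.
by move/eqP; rewrite -size_poly_eq0 sP.
Qed.

End PrimeField.

(** * The invariants attached to Jordan coordinates *)

Section JordanInvariants.

Variables (F : fieldType) (gT : finGroupType) (G : {group gT}) (n : nat).
Variables (rG : mx_representation F G n) (g : gT) (p : nat).
Variables (s : nat) (k : 'I_s -> nat) (b : 'I_s -> nat -> 'cV[F]_n).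
(** The reference block [i0] is encoded as a function [base] that is constant on
the nontrivial blocks.  This also covers the case in which there is no
nontrivial block, and that in which there is no block at all. *)
Variable base : 'I_s -> 'I_s.
Hypotheses (genG : G :=: <[g]>%g) (chF : p \in [pchar F]).
Hypothesis k_bounds : forall i, (0 < k i <= p)%N.
Hypothesis b_coord : jordan_coordinates (rG g^-1%g - 1%:M) k b.
Hypothesis base_nontriv : forall i, (1 < k i)%N -> (1 < k (base i))%N.
Hypothesis base_const :
  forall i j, (1 < k i)%N -> (1 < k j)%N -> base i = base j.

Local Notation sigma := (mpoly_act_rmorphism rG g).

Definition coord i j : {mpoly F[n]} := linear_form (b i j).

Definition degree_p_invariant i : {mpoly F[n]} :=
  if i == base i then norm_invariant p (coord i)
  else coord (base i) 0 ^+ (p - 2) * quadratic_invariant (coord (base i)) (coord i).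

Definition generator i j : {mpoly F[n]} :=
  match j with
  | 0 => coord i 0
  | 1 => degree_p_invariant i
  | _ => cubic_invariant sigma (coord i) j
  end.

Let k_gt0 i : (0 < k i)%N. Proof. by have /andP[] := k_bounds i. Qed.
Let p_prime : prime p. Proof. exact: pcharf_prime chF. Qed.
Let Gg : g \in G. Proof. by rewrite genG cycle_id. Qed.

Let baseK i : (1 < k i)%N -> base (base i) = base i.
Proof. by move=> ki; apply: base_const; rewrite ?base_nontriv. Qed.

Lemma coord0_fixed i : sigma (coord i 0) = coord i 0.
Proof.
have [b0 _ _ _] := b_coord; rewrite -mpoly_actE mpoly_act_linear_form.
by rewrite -[X in X *m _](subrK 1%:M) mulmxDl b0 mul1mx add0r.
Qed.

Lemma coordS_act i j : (j.+1 < k i)%N ->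
  sigma (coord i j.+1) = coord i j.+1 + coord i j.
Proof.
move=> jk; have [_ bS _ _] := b_coord; rewrite -mpoly_actE mpoly_act_linear_form.
by rewrite -[X in X *m _](subrK 1%:M) mulmxDl bS // mul1mx linear_formD addrC.
Qed.

Lemma generator_invariant i j : (j < k i)%N -> invariant rG (generator i j).
Proof.
move=> jk; apply: (invariant_generator genG); rewrite mpoly_actE.
case: j jk => [|[|j]] jk; first exact: coord0_fixed; last first.
  exact: (cubic_invariant_fixed (coord0_fixed i) (@coordS_act i)).
rewrite /= /degree_p_invariant; case: ifP => _.
  apply: (norm_invariant_fixed (coord0_fixed i) (@coordS_act i)) => //.
  by rewrite (rmorph_pchar (@mpolyC n F : {rmorphism F -> {mpoly F[n]}})).
rewrite rmorphM rmorphXn coord0_fixed; congr (_ * _).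
exact: (quadratic_invariant_fixed (coord0_fixed _) (@coordS_act _)
  (coord0_fixed i) (@coordS_act i) (base_nontriv jk) jk).
Qed.

Definition generator_degree j := match j with 0 => 1%N | 1 => p | _ => 3 end.

Lemma coord_homog i j : coord i j \is 1.-homog.
Proof. exact: linear_form_homog. Qed.

Lemma generator_homog i j : generator i j \is (generator_degree j).-homog.
Proof.
have p2 := prime_gt1 p_prime.
have homM d1 d2 d (f h : {mpoly F[n]}) : (d1 + d2)%N = d ->
    f \is d1.-homog -> h \is d2.-homog -> f * h \is d.-homog.
  by move=> <-; apply: dhomogM.
have homX d f : f \is 1.-homog -> f ^+ d \is [in F[n], d.-homog].
  by move=> hf; have := dhomogMn d hf; rewrite mul1n.
have hx := coord_homog; case: j => [|[|j]]; first exact: hx.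
  rewrite /= /degree_p_invariant; case: ifP => _.
    apply: rpredB; first exact: homX.
    by apply: (homM 1%N p.-1) => //; [rewrite add1n prednK // ltnW | apply: homX].
  apply: (homM (p - 2)%N 2) => //; [by rewrite subnK | exact: homX |].
  by apply: rpredB; apply: (homM 1%N 1%N).
apply: rpred_sum => l _; apply: (homM 1%N 2) => //.
  rewrite /opposite_chain -signr_odd mulr_sign.
  set x := iter _ _ _; suff: x \is 1.-homog by case: ifP; rewrite ?rpredN.
  rewrite /x; set d := (_ - _)%N; have [c ->] : exists c,
      iter d sigma (coord i d) = linear_form c; last exact: linear_form_homog.
  elim: {1}d => [|e [c ec]]; first by exists (b i d).
  by exists (rG g^-1%g *m c); rewrite iterS ec -mpoly_act_linear_form.
rewrite /wronskian_chain !mulr_natl.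
by apply: rpredB; apply: (homM 1%N 1%N); rewrite ?rpredD ?rpredMn.
Qed.

Lemma coord_eval (c : 'I_s -> nat -> F) : exists v : 'rV[F]_n,
  forall i j, (j < k i)%N -> (coord i j).@[v 0] = c i j.
Proof.
have [_ _ /(_ c)[v vP] _] := b_coord.
by exists v => i j jk; rewrite meval_linear_form vP.
Qed.

Lemma coord_ind (Q : {mpoly F[n]} -> Prop) :
    subring_pred Q -> (forall a, Q a%:MP) ->
    (forall i j, (j < k i)%N -> Q (coord i j)) ->
  forall f, Q f.
Proof.
move=> Qring QC Qx; apply: mpoly_subring_ind => // c.
have [_ _ _ /(_ c)[a ->]] := b_coord; rewrite linear_form_sum.
apply: subring_pred_sum => // i _; rewrite linear_form_sum.
apply: subring_pred_sum => // j _; rewrite linear_formZ.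
by apply: subring_predM => //; apply: Qx.
Qed.

Lemma natF_neq0 i j : (0 < j < k i)%N -> j%:R != 0 :> F.
Proof.
move=> /andP[j0 jk]; rewrite -(dvdn_pcharf chF) gtnNdvd //.
by have /andP[_] := k_bounds i; apply: leq_trans.
Qed.

(** The triangular shape of the generators.  The property [Q] is instantiated by
taking equal values at two points, by membership in a field of fractions, and by
being polynomial in [y] over such a field; in each case [x i 0] can be
cancelled. *)
Lemma generator_solve (Q : {mpoly F[n]} -> Prop) :
    subring_pred Q -> (forall a, Q a%:MP) ->
    (forall i f, (1 < k i)%N -> Q (coord i 0 * f) -> Q f) ->
    (forall i j, (j < k i)%N -> Q (generator i j)) ->
    (forall i, (1 < k i)%N -> Q (coord (base i) 1)) ->
  forall f, Q f.
Proof.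
move=> Qring QC cancel Qgen Qbase; apply: coord_ind => // i j.
have cancelX i' d f : (1 < k i')%N -> Q (coord i' 0 ^+ d * f) -> Q f.
  move=> ki; elim: d => [|d IH]; first by rewrite mul1r.
  by rewrite exprS -mulrA => /(cancel _ _ ki).
have Qx0 i' : Q (coord i' 0) by apply: (Qgen i' 0).
have [q] := ubnP j; elim: q => // q IH in j *; rewrite ltnS => jq jk.
case: j => [|[|j]] in jq jk *; first exact: Qx0.
  have := Qgen i 1%N jk; rewrite /= /degree_p_invariant.
  case: eqP => [-> _|_]; first exact: Qbase.
  move=> /(cancelX _ _ _ (base_nontriv jk)) Qq.
  apply: (cancel _ _ (base_nontriv jk)).
  have -> : coord (base i) 0 * coord i 1 =
    coord (base i) 1 * coord i 0 - quadratic_invariant (coord (base i)) (coord i).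
    by rewrite /quadratic_invariant; ring.
  by apply: subring_predB => //; apply: subring_predM => //; apply: Qbase.
have jb : (1 < j.+2 < k i)%N by [].
have lower l : (l < j.+2)%N -> Q (coord i l).
  by move=> lj; apply: IH; lia.
have lead := cubic_invariant_leading (coord0_fixed i) (@coordS_act i) jb Qring lower.
have := subring_predB Qring (Qgen i _ jk) lead.
rewrite opprB addrC subrK -mulrnAr => /(cancelX _ _ _ (ltn_trans _ jk))-/(_ isT) Qj.
have := subring_predM Qring (QC (j.+2%:R^-1)) Qj.
rewrite mul_mpolyC -scaler_nat scalerA mulVf ?scale1r //.
by apply: (@natF_neq0 i); rewrite jk.
Qed.

Lemma generator_sub (Q : {mpoly F[n]} -> Prop) i j :
    subring_pred Q -> (j < k i)%N ->
    (forall l, (l <= j)%N -> Q (coord i l)) ->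
    (j = 1%N -> forall l, (l <= 1)%N -> Q (coord (base i) l)) ->
  Q (generator i j).
Proof.
move=> Qring jk; case: j => [|[|j]] in jk * => Qx Qb.
- exact: Qx.
- have {}Qb := Qb erefl; rewrite /= /degree_p_invariant.
  case: ifP => _; rewrite /norm_invariant /quadratic_invariant.
    by apply: subring_predB => //; try apply: subring_predM => //;
       try apply: subring_predX => //; apply: Qx.
  apply: subring_predM => //; first by apply: subring_predX => //; apply: Qb.
  by apply: subring_predB => //; apply: subring_predM => //;
     first [exact: Qx | exact: Qb].
have jb : (1 < j.+2 < k i)%N by [].
have lower l : (l < j.+2)%N -> Q (coord i l) by move=> /ltnW/Qx.
have lead := cubic_invariant_leading (coord0_fixed i) (@coordS_act i) jb Qring lower.
have {}lead := subring_predD Qring lead.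
rewrite -[generator _ _](subrK (coord i 0 ^+ 2 * coord i j.+2 *+ j.+2)).
apply: lead; apply: subring_predMn => //; apply: subring_predM => //.
  by apply: subring_predX => //; apply: Qx.
exact: Qx.
Qed.

Lemma eval_eq_subring (v w : 'rV[F]_n) :
  subring_pred (fun f : {mpoly F[n]} => f.@[v 0] = f.@[w 0]).
Proof.
split=> [|f h|f h]; first by rewrite !meval1.
  by rewrite !mevalB => -> ->.
by rewrite !mevalM => -> ->.
Qed.

(** For [j > 0], the invariant attached to [(i, j)] really involves the
coordinate [(i, j)]: it distinguishes the point [v] whose only nonzero
coordinates are the [x i 0 = 1] from the point [w] obtained by setting
coordinate [(i, j)] to 1 as well.  The norm of the reference block is excluded,
since for [c = 1] it vanishes on the prime field. *)
Lemma generator_depends i j : (0 < j < k i)%N -> ~~ ((j == 1%N) && (i == base i)) ->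
  exists v w : 'rV[F]_n, (generator i j).@[v 0] != (generator i j).@[w 0] /\
    forall i' j', (j' < k i')%N -> (i', j') != (i, j) ->
      (coord i' j').@[v 0] = (coord i' j').@[w 0].
Proof.
move=> /andP[j0 jk] nij.
have [v vP] := coord_eval (fun _ l => (l == 0)%:R).
have [w wP] := coord_eval (fun i' l => ((l == 0) || ((i', l) == (i, j)))%:R).
exists v, w; have vw i' j' : (j' < k i')%N -> (i', j') != (i, j) ->
    (coord i' j').@[v 0] = (coord i' j').@[w 0].
  by move=> jk' ne; rewrite vP // wP // (negPf ne) orbF.
split=> //; apply/eqP => gvw.
case: j => [|[|j]] // in j0 jk nij wP vw gvw *.
  have nb : (i == base i) = false by apply/negbTE.
  have kb := base_nontriv jk.
  move: gvw; rewrite /= /degree_p_invariant nb /quadratic_invariant.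
  rewrite !mevalM !rmorphXn !mevalB !mevalM /= !vP ?wP ?k_gt0 //=.
  rewrite !xpair_eqE !eqxx [base i == i]eq_sym nb expr1n !mul1r !mul0r subr0.
  by rewrite sub0r => /esym/eqP; rewrite oppr_eq0 oner_eq0.
have jb : (1 < j.+2 < k i)%N by [].
have lower l : (l < j.+2)%N -> (coord i l).@[v 0] = (coord i l).@[w 0].
  by move=> lj; apply: vw; [lia | rewrite xpair_eqE eqxx /=; lia].
have lead := cubic_invariant_leading (coord0_fixed i) (@coordS_act i) jb
  (eval_eq_subring v w) lower.
have := subring_predB (eval_eq_subring v w) gvw lead.
rewrite opprB addrC subrK /= !mevalMn !mevalM !vP // !wP //=.
rewrite eqxx mulr0 mul0rn !mul1r => /esym/eqP.
by rewrite (negPf (@natF_neq0 i _ _)) // jk.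
Qed.

Lemma generator_neq0 i j : (j < k i)%N -> generator i j != 0.
Proof.
move=> jk; case: j => [|j] in jk *.
  have [v vP] := coord_eval (fun _ _ => 1).
  apply: contraTneq (oner_neq0 F) => g0.
  by rewrite -(vP _ _ jk) [coord i 0]g0 meval0 eqxx.
have [/andP[/eqP[j0] /eqP ib]|] := boolP ((j.+1 == 1%N) && (i == base i)).
  have [v vP] := coord_eval (fun _ l => (l == 1)%:R).
  subst j; apply: contraTneq (oner_neq0 F) => g0.
  have := congr1 (meval (v 0)) g0; rewrite meval0 /= /degree_p_invariant -ib eqxx.
  rewrite /norm_invariant mevalB mevalM !rmorphXn /= !vP //= expr1n mul1r.
  have p2 := prime_gt1 p_prime.
  by rewrite expr0n -subn1 subn_eq0 leqNgt p2 subr0 => ->; rewrite eqxx.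
move=> nij; have [//|v [w [neq _]]] := @generator_depends i j.+1 _ nij.
by apply: contraNneq neq => ->; rewrite !meval0.
Qed.

(** The linear invariants are told apart from the others by their degree.  Of two
nonlinear ones, the one with the larger index [j] depends on a coordinate that
does not occur in the other one.  For [j = 1] the norm of the reference block has
to come first, as the other invariants of degree [p] involve its coordinate. *)
Lemma generator_inj i j i' j' : (j < k i)%N -> (j' < k i')%N ->
  generator i j = generator i' j' -> (i, j) = (i', j').
Proof.
have deg0 a c c' : (c'.+1 < k c)%N -> generator a 0 <> generator c c'.+1.
  move=> kc e; have := generator_homog c c'.+1; rewrite -e => h.
  have := dhomog_uniq (generator_neq0 (k_gt0 a)) h (generator_homog a 0).
  by case: (c') => /= [p1|//]; have := p_prime; rewrite p1.
wlog: i j i' j' / (j <= j')%N && ~~ [&& j' == 1, j == 1 & i' == base i']%N.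
  move=> W jk jk' e; have [jj'|j'j] := leqP j j'; last first.
    by apply/esym/W => //; rewrite (ltnW j'j) /=; lia.
  have [/and3P[/eqP j'1 /eqP j1 /eqP i'b]|nW] :=
    boolP [&& j' == 1, j == 1 & i' == base i']%N; last by apply: W; rewrite ?jj'.
  subst j j'; have [/eqP ib|ib] := boolP (i == base i).
    by rewrite ib i'b; congr (_, _); apply: base_const.
  by apply/esym/W => //=; rewrite ib.
case/andP=> jj' nW jk jk' e; apply/eqP; apply: contraT => ne.
case: j' => [|j'] in jj' nW jk' e ne *.
  move: jj' jk e ne; rewrite leqn0 => /eqP-> jk e ne.
  have [v vP] := coord_eval (fun a _ => (a == i)%:R).
  have := congr1 (meval (v 0)) e; rewrite /= !vP // eqxx.
  move: ne; rewrite xpair_eqE andbT [i' == i]eq_sym => /negPf-> /eqP.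
  by rewrite oner_eq0.
case: j => [|j] in jj' nW jk e ne *; first by case: (deg0 _ _ _ jk' e).
have [||v [w [neq vw]]] := @generator_depends i' j'.+1.
- by rewrite jk'.
- move: nW; apply: contraNN => /andP[j'1 i'b]; rewrite j'1 i'b andbT; lia.
case/negP: neq; apply/eqP; rewrite -e.
apply: (generator_sub (eval_eq_subring v w)) => // [l lj|j1 l l1].
  apply: vw; first by apply: leq_ltn_trans jk.
  apply: contraNneq ne => -[-> l']; rewrite xpair_eqE eqxx /=; lia.
have ki : (1 < k i)%N by rewrite -j1.
have ki' : (1 < k i')%N by apply: leq_ltn_trans jk'.
apply: vw; first by apply: leq_ltn_trans (base_nontriv ki).
rewrite (base_const ki ki'); apply: contraNneq nW => -[bi' l'].
by rewrite bi' eqxx j1 andbT /=; lia.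
Qed.


Lemma coord1_translate i d : (1 < k i)%N ->
  mpoly_act rG (g ^+ d)%g (coord i 1) = coord i 1 + coord i 0 *+ d.
Proof.
move=> ki; rewrite mpoly_actX //; elim: d => [|d IH]; first by rewrite addr0.
rewrite iterS IH mpoly_actE rmorphD rmorphMn coordS_act // coord0_fixed.
by rewrite mulrS addrA.
Qed.

(** The Artin-Schreier equation for the reference block provides the group
element; the other coordinates follow by [generator_solve]. *)
Lemma generator_separates (v w : 'rV[F]_n) :
    (forall i, (coord i 0).@[w 0] != 0) ->
    (forall i j, (j < k i)%N -> (generator i j).@[v 0] = (generator i j).@[w 0]) ->
  exists2 h, h \in G & v = w *m rG h.
Proof.
move=> w0 vw.
suff [d vd] : exists d, forall i, (1 < k i)%N ->
    (coord (base i) 1).@[v 0] = (coord (base i) 1).@[(w *m rG (g ^+ d)^-1%g) 0].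
  exists (g ^+ d)^-1%g; first by rewrite groupV groupX.
  have wdP f : invariant rG f -> f.@[(w *m rG (g ^+ d)^-1%g) 0] = f.@[w 0].
    by move=> fG; apply: (invariant_meval _ fG); rewrite groupV groupX.
  set wd := w *m _ in vd wdP *.
  suff Q f : f.@[v 0] = f.@[wd 0] by apply/rowP => a; have := Q 'X_a; rewrite !mevalXU.
  move: f; apply: generator_solve => //; first exact: eval_eq_subring.
  - by move=> a; rewrite !mevalC.
  - move=> i f ki; rewrite !mevalM (vw i 0) ?(ltnW ki) //.
    rewrite [in X in _ = X -> _]wdP; last exact: (generator_invariant (k_gt0 i)).
    by move/mulfI; apply; apply: w0.
  by move=> i j jk; rewrite vw // wdP //; apply: generator_invariant.
case: (pickP (fun i => 1 < k i)%N) => [i ki|nk]; last by exists 0 => i; rewrite nk.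
have kb := base_nontriv ki; set i0 := base i in kb.
have := vw i0 1%N kb; rewrite /= /degree_p_invariant baseK // eqxx.
rewrite /norm_invariant !mevalB !mevalM !rmorphXn /= (vw i0 0) ?(ltnW kb) //.
move=> /(artin_schreier_root chF (w0 i0))[d vd].
exists d => i' ki'; rewrite (base_const ki' ki) -/i0 vd -meval_mpoly_act.
by rewrite coord1_translate // mevalD mevalMn.
Qed.

Local Notation L := {fraction {mpoly F[n]}}.
Local Notation tofrac := (@FracField.tofrac {mpoly F[n]}).

Variable S : {mpoly F[n]} -> Prop.
Hypothesis S_invariant : forall f, S f -> invariant rG f.
Hypothesis S_generator : forall i j, (j < k i)%N -> S (generator i j).

Local Notation K := (subfield_gen
  (fun x => (exists c : F, x = tofrac c%:MP) \/
            (exists2 f, S f & x = tofrac f))).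

Lemma subfield_gen_fixed x : K x -> frac_invariant rG x.
Proof.
move=> Kx h Gh; rewrite (frac_act_rmorphismE rG Gh).
elim: Kx => {x} [x [[c ->]|[f Sf ->]]||x y _ xE _ yE|x y _ xE _ yE].
- by rewrite -frac_act_rmorphismE frac_act_tofrac // mpoly_actC.
- by rewrite -frac_act_rmorphismE frac_act_tofrac // S_invariant.
- exact: rmorph1.
- by rewrite rmorphB xE yE.
- by rewrite fmorph_div xE yE.
Qed.

Let Kring : subring_pred (K : L -> Prop) := subfield_gen_subring _.
Let KC a : K (tofrac a%:MP). Proof. by apply: Subfield_base; left; exists a. Qed.
Let Kgen i j : (j < k i)%N -> K (tofrac (generator i j)).
Proof. by move=> jk; apply: Subfield_base; right; exists (generator i j); auto. Qed.

Let coord0_frac_neq0 i : tofrac (coord i 0) != 0.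
Proof. by rewrite tofrac_eq0; apply: (@generator_neq0 i 0). Qed.

(** The bound on the degree is what makes [p] roots enough to conclude that a
polynomial vanishes. *)
Definition poly_span (y x : L) : Prop := exists P : {poly L},
  [/\ (size P <= p)%N, forall i, K P`_i & x = P.[y]].

Lemma poly_span_sub y x1 x2 :
  poly_span y x1 -> poly_span y x2 -> poly_span y (x1 - x2).
Proof.
move=> [P [sP KP ->]] [P' [sP' KP' ->]]; exists (P - P'); split.
- by rewrite (leq_trans (size_polyD _ _)) // size_polyN geq_max sP.
- by move=> i; rewrite coefB; apply: subring_predB.
- by rewrite !hornerE.
Qed.

Lemma poly_spanZ y a x : K a -> poly_span y x -> poly_span y (a * x).
Proof.
move=> Ka [P [sP KP ->]]; exists (a *: P); split.
- by rewrite (leq_trans (size_scale_leq _ _)).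
- by move=> i; rewrite coefZ; apply: subring_predM.
- by rewrite !hornerE.
Qed.

Lemma poly_spanC y a : K a -> poly_span y a.
Proof.
move=> Ka; exists a%:P; split; last by rewrite hornerC.
  by rewrite (leq_trans (size_polyC_leq1 _)) // prime_gt0.
by move=> i; rewrite coefC; case: ifP => // _; apply: subring_pred0.
Qed.

(** If the multiplication by [y] raises the degree to [p], the relation
satisfied by [y] brings it down again. *)
Lemma poly_span_mul_root y e1 e0 x : K e1 -> K e0 -> y ^+ p = e1 * y + e0 ->
  poly_span y x -> poly_span y (y * x).
Proof.
move=> Ke1 Ke0 yp [P [sP KP ->]]; have p2 := prime_gt1 p_prime.
exists (P * 'X - P`_p.-1 *: ('X^p - (e1 *: 'X + e0%:P))); split.
- apply/leq_sizeP => j pj; rewrite coefB coefMX coefZ coefB coefXn coefD coefZ coefX coefC.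
  have -> : (j == 0)%N = false by lia.
  have -> : (j == 1)%N = false by lia.
  have [->|jp] := eqVneq j p; first by rewrite mulr0 addr0 subr0 mulr1 subrr.
  rewrite nth_default ?mulr0 ?addr0 ?subr0 ?mulr0 ?subr0 //.
  by rewrite (leq_trans sP) //; lia.
- move=> j; rewrite coefB coefMX coefZ coefB coefXn coefD coefZ coefX coefC.
  have Kn m : K m%:R by apply: subring_predMn => //; have [] := Kring.
  have K0 := subring_pred0 Kring.
  apply: subring_predB => //; first by case: ifP.
  apply: subring_predM => //; apply: subring_predB => //.
  apply: subring_predD => //; first exact: subring_predM.
  by case: ifP.
- rewrite !(hornerD, hornerN, hornerXn, hornerZ, hornerX, hornerC, hornerMX).
  by rewrite yp; ring.
Qed.

Lemma poly_spanM y e1 e0 x1 x2 : K e1 -> K e0 -> y ^+ p = e1 * y + e0 ->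
  poly_span y x1 -> poly_span y x2 -> poly_span y (x1 * x2).
Proof.
move=> Ke1 Ke0 yp [P [_ KP ->]] x2y; rewrite horner_coef mulr_suml.
have span0 : poly_span y 0 by apply/poly_spanC/(subring_pred0 Kring).
apply: (big_ind (poly_span y)) => // [a b' ay b'y|i _].
  rewrite -[b']opprK -[- b']sub0r; apply: poly_span_sub => //.
  exact: poly_span_sub.
rewrite -mulrA; apply: poly_spanZ => //.
elim: (i : nat) => [|e IH]; first by rewrite mul1r.
by rewrite exprS -mulrA; apply: poly_span_mul_root yp _.
Qed.

Lemma poly_span_all i f : (1 < k i)%N ->
  poly_span (tofrac (coord (base i) 1)) (tofrac f).
Proof.
move=> ki; set y := tofrac _; have kb := base_nontriv ki.
pose c := tofrac (coord (base i) 0).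
have Kc : K c by apply: (Kgen (k_gt0 (base i))).
pose e0 := tofrac (generator (base i) 1).
have Ke0 : K e0 by apply: Kgen.
have yp : y ^+ p = c ^+ p.-1 * y + e0.
  rewrite /e0 /= /degree_p_invariant baseK // eqxx /norm_invariant.
  by rewrite rmorphB rmorphM !rmorphXn /= -/y -/c; ring.
have Kcp : K (c ^+ p.-1) by apply: subring_predX.
move: f; apply: generator_solve.
- split=> [|f h|f h].
  + by rewrite rmorph1; apply: poly_spanC; have [] := Kring.
  + by rewrite rmorphB; apply: poly_span_sub.
  + by rewrite rmorphM; apply: poly_spanM yp.
- by move=> a; apply: poly_spanC.
- move=> i' f ki'; rewrite rmorphM => fy.
  rewrite -[tofrac f](mulKf (coord0_frac_neq0 i')); apply: poly_spanZ => //.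
  rewrite -div1r; apply: Subfield_div; first exact: Subfield_one.
  exact: (Kgen (k_gt0 i')).
- by move=> i' j jk; apply/poly_spanC/Kgen.
move=> i' ki'; rewrite (base_const ki' ki) -/y.
have := poly_span_mul_root Kcp Ke0 yp (poly_spanC y (Subfield_one _)).
by rewrite mulr1.
Qed.

(** Write [q] as a quotient of [P(y)] by [P'(y)] with [P] and [P'] of degree less
than [p] over [K].  The powers of [g] fix [q] and [K] and translate [y] by
multiples of [c], so [P - q P'] has [p] roots and vanishes; comparing
coefficients at the degree of [P'] gives [q] in [K]. *)
Lemma frac_invariant_subfield_gen q : frac_invariant rG q -> K q.
Proof.
move=> qG; have [a [d [d0 qE]]] := fraction_div q.
case: (pickP (fun i => 1 < k i)%N) => [i ki|nk]; last first.
  suff Q f : K (tofrac f) by rewrite qE; apply: Subfield_div.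
  move: f; apply: generator_solve => //; last by move=> i; rewrite nk.
  + split=> [|f h|f h]; first by rewrite rmorph1; apply: Subfield_one.
      by rewrite rmorphB; apply: subring_predB.
    by rewrite rmorphM; apply: subring_predM.
  + by move=> i f; rewrite nk.
have kb := base_nontriv ki.
have [P [sP KP aP]] := poly_span_all a ki.
have [P' [sP' KP' dP']] := poly_span_all d ki.
set y := tofrac (coord (base i) 1) in aP dP'.
pose c := tofrac (coord (base i) 0).
have chL : p \in [pchar L].
  rewrite (rmorph_pchar (tofrac : {rmorphism {mpoly F[n]} -> L})) //.
  by rewrite (rmorph_pchar (@mpolyC n F : {rmorphism F -> {mpoly F[n]}})).
have tofracd : tofrac d != 0 by rewrite tofrac_eq0.
have P0 : P - q *: P' = 0.
  apply: (poly_eq0_translates chL (coord0_frac_neq0 (base i)) (y := y)).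
    rewrite (leq_trans (size_polyD _ _)) // size_polyN geq_max sP.
    by rewrite (leq_trans (size_scale_leq _ _)).
  move=> e _; have Ge : (g ^+ e)%g \in G by rewrite groupX.
  have [theta thetaE] : exists theta : {rmorphism L -> L}, frac_act rG (g ^+ e)%g =1 theta.
    by exists (frac_act_rmorphism rG Ge).
  have thetaK x : frac_invariant rG x -> theta x = x.
    by move=> xG; rewrite -thetaE xG.
  have <- : theta y = y + c *+ e.
    rewrite -thetaE frac_act_tofrac // coord1_translate //.
    by rewrite rmorphD rmorphMn.
  have <- : map_poly theta (P - q *: P') = P - q *: P'.
    apply/polyP => j; rewrite coef_map !(coefB, coefZ) /= rmorphB rmorphM /=.
    by rewrite (thetaK q) // !thetaK //; apply: subfield_gen_fixed.
  rewrite horner_map hornerD hornerN hornerZ -aP -dP' qE.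
  by rewrite divfK // subrr rmorph0.
have /negPf P'0 : P' != 0 by apply: contraNneq tofracd => P'0; rewrite dP' P'0 horner0.
have lead : lead_coef P' != 0 by rewrite lead_coef_eq0 P'0.
have -> : q = P`_(size P').-1 / lead_coef P'.
  apply: (canRL (mulfK lead)).
  by move/eqP: P0; rewrite subr_eq0 => /eqP->; rewrite coefZ.
by rewrite /lead_coef; apply: Subfield_div.
Qed.

End JordanInvariants.

(** * Counting the generators *)

Section Labels.

Variables (s : nat) (k : 'I_s -> nat).
Hypothesis k_gt0 : forall i, (0 < k i)%N.

Definition linear_labels : seq ('I_s * nat) := [seq (i, 0%N) | i <- enum 'I_s].

Definition degree_p_labels : seq ('I_s * nat) :=
  [seq (i, 1%N) | i <- enum 'I_s & (1 < k i)%N].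

Definition cubic_labels : seq ('I_s * nat) :=
  [seq (i, j) | i <- enum 'I_s, j <- iota 2 (k i - 2)].

Definition labels := linear_labels ++ degree_p_labels ++ cubic_labels.

Lemma mem_labels i j : ((i, j) \in labels) = (j < k i)%N.
Proof.
rewrite !mem_cat; apply/idP/idP => [/or3P[]|jk].
- by case/mapP=> i' _ [-> ->].
- by case/mapP=> i'; rewrite mem_filter => /andP[ki _] [-> ->].
- by case/allpairsPdep=> i' [j' [_ j'k [-> ->]]]; move: j'k; rewrite mem_iota; lia.
case: j => [|[|j]] in jk *; apply/or3P.
- by apply/Or31/mapP; exists i; rewrite ?mem_enum.
- by apply/Or32/mapP; exists i; rewrite // mem_filter jk mem_enum.
- apply/Or33/allpairsPdep; exists i, j.+2; split; rewrite ?mem_enum //.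
  by rewrite mem_iota; lia.
Qed.

Lemma size_linear_labels : size linear_labels = s.
Proof. by rewrite size_map size_enum_ord. Qed.

Lemma size_degree_p_labels : size degree_p_labels = #|[set i | (1 < k i)%N]|.
Proof.
rewrite size_map -sum1_size big_filter big_enum_cond -sum1_card.
by apply: eq_bigl => i; rewrite in_set.
Qed.

Lemma size_labels : size labels = (\sum_i k i)%N.
Proof.
rewrite !size_cat size_linear_labels size_degree_p_labels size_allpairs_dep.
rewrite sumnE big_map big_enum /= -[X in (X + _)%N]card_ord -!sum1_card.
rewrite [X in (_ + (X + _))%N](eq_bigl (fun i => 1 < k i)%N); last first.
  by move=> i; rewrite in_set.
rewrite [X in (_ + (X + _))%N]big_mkcond -!big_split /=.
apply: eq_bigr => i _; rewrite size_iota; have := k_gt0 i.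
by case: (k i) => [|[|d]] // _; rewrite subn2 /= addnA.
Qed.

Lemma uniq_labels : uniq labels.
Proof.
have inj0 j : injective (fun i : 'I_s => (i, j)) by move=> i i' [].
rewrite !cat_uniq !map_inj_uniq //; try exact: inj0.
rewrite filter_uniq ?enum_uniq //= -!all_predC all_cat.
rewrite -enumT enum_uniq /=; apply/and3P; split.
- apply/andP; split; apply/allP => l /=.
    by move=> /mapP[i _ ->]; apply/mapP => -[i' _ []].
  case/allpairsPdep=> i [j [_ jk ->]]; apply/mapP => -[i' _ [_ j0]].
  by move: jk; rewrite j0 mem_iota.
- apply/allP => l /allpairsPdep[i [j [_ jk ->]]] /=; apply/mapP => -[i' _ [_ j0]].
  by move: jk; rewrite j0 mem_iota.
- apply: allpairs_uniq_dep => [|i _|]; rewrite ?enum_uniq ?iota_uniq //.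
  by move=> [i j] [i' j'] _ _ /= [-> ->].
Qed.

End Labels.

(** * The theorem *)

Theorem theorem4 (gT : finGroupType) (G : {group gT}) (p : nat)
    (F : fieldType) (n : nat) (rG : mx_representation F G n)
    (s : nat) (W : 'I_s -> 'M[F]_n) (r m : nat) :
  prime p -> cyclic G -> #|G| = p -> p \in [pchar F] ->
  indecomposable_decomposition rG W ->
  r = #|[set i | trivial_summand rG (W i)]| ->
  m = #|[set i | ~~ trivial_summand rG (W i)]| ->
  (m + r)%N = \rank (rfix_mx rG G) /\
  exists (f1 : (m + r)%N.-tuple {mpoly F[n]}) (fp : m.-tuple {mpoly F[n]})
         (f23 : (n - 2 * m - r)%N.-tuple {mpoly F[n]}),
    let S : seq {mpoly F[n]} := f1 ++ fp ++ f23 in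
    [/\ size S = n /\ uniq S,
        [/\ forall f, f \in f1 -> homog_invariant rG 1 f,
            forall f, f \in fp -> homog_invariant rG p f
          & forall f, f \in f23 ->
              homog_invariant rG 2 f \/ homog_invariant rG 3 f],
        generically_separating rG (fun f => f \in S)
      & generate_invariant_field rG (fun f => f \in S)].
Proof.
move=> p_prime /cyclicP[g genG] oG chF decW rE mE.
have genGV : G :=: <[g^-1]>%g by rewrite cycleV.
have [k [b [k_bounds sum_k triv coords]]] :=
  indecomposable_jordan_coordinates genGV oG chF decW.
have k_gt0 i : (0 < k i)%N by have /andP[] := k_bounds i.
have mrE : (m + r)%N = s.
  rewrite rE mE -[RHS]card_ord -(cardsC [set i | trivial_summand rG (W i)]) addnC.
  by congr (_ + _)%N; apply: eq_card => i; rewrite !inE.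
have mE' : m = #|[set i | (1 < k i)%N]|.
  rewrite mE; apply: eq_card => i; rewrite !inE triv.
  by have := k_gt0 i; case: (k i) => [|[]].
split; first by rewrite mrE (rank_rfix_jordan genGV k_gt0 coords).
pose base i := odflt i [pick i' | (1 < k i')%N].
have base_nontriv i : (1 < k i)%N -> (1 < k (base i))%N.
  by rewrite /base => ki; case: pickP => //= /(_ i); rewrite ki.
have base_const i i' : (1 < k i)%N -> (1 < k i')%N -> base i = base i'.
  by rewrite /base => ki _; case: pickP => //= /(_ i); rewrite ki.
pose gen (l : 'I_s * nat) := generator rG g p b base l.1 l.2.
have gen_homog i j : (j < k i)%N ->
    homog_invariant rG (generator_degree p j) (gen (i, j)).
  move=> jk; split; last exact: (generator_invariant genG chF coords base_nontriv).
    exact: (generator_neq0 genG chF k_bounds coords base_nontriv).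
  exact: generator_homog.
have size1 : size [seq gen l | l <- linear_labels s] == (m + r)%N.
  by rewrite size_map size_linear_labels mrE.
have sizep : size [seq gen l | l <- degree_p_labels k] == m.
  by rewrite size_map size_degree_p_labels mE'.
have size23 : size [seq gen l | l <- cubic_labels k] == (n - 2 * m - r)%N.
  have := size_labels k_gt0; rewrite sum_k !size_cat size_linear_labels.
  rewrite size_degree_p_labels -mE' size_map; lia.
exists (Tuple size1), (Tuple sizep), (Tuple size23) => S.
have SE : S = [seq gen l | l <- labels k] by rewrite /labels !map_cat.
have gen_inj : {in labels k &, injective gen}.
  move=> [i j] [i' j']; rewrite !mem_labels // => jk jk'.
  exact: (generator_inj genG chF k_bounds coords base_nontriv base_const jk jk').
have S_gen i j : (j < k i)%N -> gen (i, j) \in S.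
  by move=> jk; rewrite SE map_f // mem_labels.
have S_inv f : f \in S -> invariant rG f.
  rewrite SE => /mapP[[i j] + ->]; rewrite mem_labels // => jk.
  by have [] := gen_homog i j jk.
split.
- split; first by rewrite SE size_map size_labels.
  by rewrite SE map_inj_in_uniq // uniq_labels.
- split=> f.
  + by case/mapP=> _ /mapP[i _ ->] ->; apply: gen_homog.
  + case/mapP=> _ /mapP[i + ->] ->; rewrite mem_filter => /andP[ki _].
    exact: gen_homog.
  + case/mapP=> _ /allpairsPdep[i [j [_ + ->]]] ->; rewrite mem_iota => jk.
    right; case: j jk => [|[|j]] // jk.
    by apply: (gen_homog i j.+2); lia.
- split=> //.
  (* This open set has a point over every field, finite or not: the [x i 0] can
     be given the value 1 simultaneously. *)
  pose h : {mpoly F[n]} := \prod_i coord b i 0.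
  have h_inv g' (v : 'rV_n) : g' \in G -> h.@[(v *m rG g') 0] = h.@[v 0].
    move=> Gg'; rewrite !rmorph_prod; apply: eq_bigr => i _ /=.
    by apply: (invariant_meval v _ Gg'); have [] := gen_homog i 0%N (k_gt0 i).
  exists (fun v => h.@[v 0] != 0); split.
  + by move=> g' v Gg' Bv; rewrite h_inv.
  + have [v vP] := coord_eval coords (fun _ _ => 1).
    exists v; rewrite rmorph_prod big1 ?oner_neq0 // => i _.
    exact: vP.
  + by exists (eq h) => v; split=> [hv|[_ <-] //]; exists h.
  move=> v w _ hw neq_orbit.
  have [/allP vw|/allPn[f Sf /eqP fvw]] := boolP (all (fun f : {mpoly F[n]} =>
    f.@[v 0] == f.@[w 0]) S); last by exists f.
  have [||h' Gh' vE] := generator_separates genG chF k_bounds coords base_nontriv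
    base_const (v := v) (w := w).
  - move=> i; move: hw; rewrite rmorph_prod /= => /prodf_neq0; exact.
  - by move=> i j jk; apply/eqP/vw/(S_gen i j jk).
  case: neq_orbit => x; rewrite vE; apply/mapP/mapP => -[y + ->]; rewrite mem_enum => Gy.
    by exists (h' * y)%g; rewrite ?mem_enum ?groupM // repr_mxM // mulmxA.
  exists (h'^-1 * y)%g; rewrite ?mem_enum ?groupM ?groupV //.
  by rewrite -mulmxA -repr_mxM ?groupM ?groupV // mulKVg.
- move=> q; split; last exact: subfield_gen_fixed.
  exact: (frac_invariant_subfield_gen genG chF k_bounds coords base_nontriv
    base_const S_inv S_gen).
Qed.
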